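(* Let $a, b$ be integers with $2 \le a < b$ and $a \mid b$. Let $(e_k)_{k\ge1}$ be a sequence of integers such that $e_1 \ge 1$ and $a^{e_k} > b^{e_{k-1}}$ for all $k \ge 2$. Let $k \ge 1$, and suppose that $N$ is a positive integer divisible by $a^{e_k}$ but not by $b$. Then $c_b(N) \ge k$.
   Context: For an integer $b \ge 2$ and a nonnegative integer $N$, $c_b(N)$ denotes the number of nonzero digits in the base-$b$ expansion of $N$. *)

(* Defs.v *)
From Stdlib Require Import ZArith Lia List.
Open Scope Z_scope.

Definition digit (b N : Z) (i : nat) : Z := (N / b ^ Z.of_nat i) mod b.

(* Positions [i < N] suffice: for [2 <= b] and [N <= i] one has [N < b ^ i], so
   digit [i] vanishes.  [nonzero_digits_expansion] below checks the count against
   an arbitrary base-[b] expansion. *)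
Definition nonzero_digits (b N : Z) : nat :=
  length (filter (fun i => negb (digit b N i =? 0)) (seq 0 (Z.to_nat N))).

(* Value in base [b] of a list of digits, least significant first. *)
Definition of_digits (b : Z) (ds : list Z) : Z :=
  fold_right (fun d acc => d + b * acc) 0 ds.

Lemma digit_0 (b d q : Z) : 0 <= d < b -> digit b (d + b * q) 0 = d.
Proof.
intros H; unfold digit; change (b ^ Z.of_nat 0) with 1.
rewrite Z.div_1_r, Z.mul_comm, Z.mod_add by lia.
now apply Z.mod_small.
Qed.

Lemma digit_S (b d q : Z) (i : nat) :
  0 <= d < b -> digit b (d + b * q) (S i) = digit b q i.
Proof.
intros H; unfold digit.
assert (0 < b ^ Z.of_nat i) by (apply Z.pow_pos_nonneg; lia).
rewrite Nat2Z.inj_succ, Z.pow_succ_r, <- Z.div_div by lia.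
now rewrite Z.mul_comm, Z.div_add, (Z.div_small d b), Z.add_0_l by lia.
Qed.

Lemma of_digits_ge0 (b : Z) (ds : list Z) :
  2 <= b -> Forall (fun d => 0 <= d < b) ds -> 0 <= of_digits b ds.
Proof. intros Hb H; induction H; simpl; nia. Qed.

Lemma count_digits (b : Z) (M : nat) : forall ds : list Z,
  2 <= b -> Forall (fun d => 0 <= d < b) ds ->
  of_digits b ds < b ^ Z.of_nat M ->
  length (filter (fun i => negb (digit b (of_digits b ds) i =? 0)) (seq 0 M)) =
  length (filter (fun d => negb (d =? 0)) ds).
Proof.
induction M as [|M IH]; intros ds Hb Hds Hlt.
- change (b ^ Z.of_nat 0) with 1 in Hlt.
  induction Hds as [|d ds Hd Hds IHds]; [reflexivity|].
  assert (H0 := of_digits_ge0 b ds Hb Hds); simpl in Hlt.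
  assert (d = 0) by nia; subst d; simpl.
  apply IHds; nia.
- destruct Hds as [|d ds Hd Hds].
  + cbn [of_digits fold_right filter length].
    generalize (seq 0 (S M)); intros l; induction l as [|i l IHl]; [reflexivity|].
    cbn [filter]; unfold digit at 1.
    now rewrite Z.div_0_l, Z.mod_0_l by (try apply Z.pow_nonzero; lia).
  + rewrite Nat2Z.inj_succ, Z.pow_succ_r in Hlt by lia; simpl in Hlt.
    assert (IH' := IH ds Hb Hds ltac:(nia)).
    change (of_digits b (d :: ds)) with (d + b * of_digits b ds).
    cbn [seq filter]; rewrite digit_0, <- seq_shift by assumption.
    assert (E : length (filter (fun i => negb (digit b (d + b * of_digits b ds) i =? 0))
                  (map S (seq 0 M))) = length (filter (fun d => negb (d =? 0)) ds)).
    { rewrite <- IH'; generalize (seq 0 M); intros l.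
      induction l as [|i l IHl]; [reflexivity|]; cbn [map filter].
      rewrite digit_S by assumption.
      destruct (negb _); cbn [length]; now rewrite IHl. }
    destruct (negb (d =? 0)); cbn [length]; now rewrite E.
Qed.

Theorem nonzero_digits_expansion (b N : Z) (ds : list Z) :
  2 <= b -> Forall (fun d => 0 <= d < b) ds -> N = of_digits b ds ->
  nonzero_digits b N = length (filter (fun d => negb (d =? 0)) ds).
Proof.
intros Hb Hds ->; apply count_digits; [assumption..|].
assert (H0 := of_digits_ge0 b ds Hb Hds).
rewrite Z2Nat.id by assumption.
now apply Z.pow_gt_lin_r; lia.
Qed.

(* Main.v *)
(* Cut the base-[b] expansion of [N] at position [e (k - 1)].  The low part is
   still divisible by [a ^ e (k - 1)], since that power divides both [N] and
   [b ^ e (k - 1)], and it is still not divisible by [b]; by induction it has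
   at least [k - 1] nonzero digits.  The high part is nonzero because
   [N >= a ^ e k > b ^ e (k - 1)], so it contributes one more. *)
Require Import Defs.
From Stdlib Require Import ZArith Lia List.
Open Scope Z_scope.

Lemma expansion_exists (b : Z) (Hb : 2 <= b) (N : Z) (HN : 0 <= N) :
  exists ds, Forall (fun d => 0 <= d < b) ds /\ N = of_digits b ds.
Proof.
revert N HN; apply Zlt_0_ind; intros N IH HN.
destruct (Z.eq_dec N 0) as [->|N0]; [now exists nil|].
destruct (IH (N / b)) as (ds & Hds & E).
- split; [apply Z.div_pos|apply Z.div_lt]; lia.
- exists (N mod b :: ds); split.
  + constructor; [apply Z.mod_pos_bound; lia|exact Hds].
  + simpl; rewrite <- E, Z.add_comm; apply Z.div_mod; lia.
Qed.

(** The range of positions counted depends on the number, so the two counts are compared through an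
    expansion of [N / b], extended by the digit [N mod b]. *)
Lemma nonzero_digits_step (b N : Z) (Hb : 2 <= b) (HN : 0 <= N) :
  nonzero_digits b N =
  ((if (N mod b =? 0)%Z then 0 else 1) + nonzero_digits b (N / b)%Z)%nat.
Proof.
destruct (expansion_exists b Hb (N / b)) as (ds & Hds & E);
  [apply Z.div_pos; lia|].
rewrite (nonzero_digits_expansion b (N / b) ds Hb Hds E).
rewrite (nonzero_digits_expansion b N (N mod b :: ds)); [|exact Hb| |].
- cbn [filter]; now destruct (N mod b =? 0).
- constructor; [apply Z.mod_pos_bound; lia|exact Hds].
- simpl; rewrite <- E, Z.add_comm; apply Z.div_mod; lia.
Qed.

(** Induction on the cut: [N] and its low part share the last digit [N mod b], and removing it from
    both leaves the same claim for [N / b], cut one place lower. *)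
Lemma nonzero_digits_split (b : Z) (Hb : 2 <= b) (n : nat) : forall N, 0 <= N ->
  nonzero_digits b N =
  (nonzero_digits b (N mod b ^ Z.of_nat n)%Z +
   nonzero_digits b (N / b ^ Z.of_nat n)%Z)%nat.
Proof.
induction n as [|n IH]; intros N HN.
- now change (b ^ Z.of_nat 0) with 1; rewrite Z.mod_1_r, Z.div_1_r.
- assert (Hpow : 0 < b ^ Z.of_nat n) by (apply Z.pow_pos_nonneg; lia).
  rewrite Nat2Z.inj_succ, Z.pow_succ_r by lia.
  assert (Hd := Z.mod_pos_bound N b ltac:(lia)).
  assert (Hr := Z.mod_pos_bound (N / b) _ Hpow).
  rewrite Z.rem_mul_r, <- Z.div_div by lia.
  rewrite (nonzero_digits_step b N), (nonzero_digits_step b (N mod b + _)) by nia.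
  rewrite (Z.mul_comm b), Z.mod_add, Z.div_add, (Z.mod_small (N mod b)),
    (Z.div_small (N mod b)), Z.add_0_l by lia.
  rewrite (IH (N / b)) by (apply Z.div_pos; lia); lia.
Qed.

Lemma nonzero_digits_pos (b : Z) (Hb : 2 <= b) (N : Z) (HN : 0 < N) :
  (1 <= nonzero_digits b N)%nat.
Proof.
assert (H0 : 0 <= N) by lia; revert HN; pattern N.
revert N H0; apply Zlt_0_ind; intros N IH _ HN.
rewrite nonzero_digits_step by lia.
(* If the last digit is 0, then [N = b * (N / b)], so [N / b] is positive and smaller than [N]. *)
destruct (Z.eqb_spec (N mod b) 0) as [E|]; [|lia].
assert (D := Z.div_mod N b ltac:(lia)).
apply IH; nia.
Qed.

(* [e 0] is unused: the sequence is indexed from 1.  [Z.pow] is [0] at negative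
   exponents, which is harmless: with either reading of negative powers the two
   hypotheses on [e] force [1 <= e j] for all [1 <= j]. *)
Theorem theorem4p1 (a b : Z) (Hab : 2 <= a < b) (Hdvd : (a | b))
  (e : nat -> Z) (He1 : 1 <= e 1%nat)
  (He : forall j : nat, (2 <= j)%nat -> a ^ e j > b ^ e (j - 1)%nat)
  (k : nat) (Hk : (1 <= k)%nat)
  (N : Z) (HN : 0 < N) (HaN : (a ^ e k | N)) (HbN : ~ (b | N)) :
  (k <= nonzero_digits b N)%nat.
Proof.
assert (He_pos : forall j, 1 <= e (S j)).
{ induction j as [|j IH]; [exact He1|].
  specialize (He (S (S j)) ltac:(lia)); simpl Nat.sub in He.
  assert (0 < b ^ e (S j)) by (apply Z.pow_pos_nonneg; lia).
  assert (b ^ 1 <= b ^ e (S j)) by (apply Z.pow_le_mono_r; lia).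
  (* An exponent below 1 would give a power of [a] at most 1, yet it must exceed [b]. *)
  destruct (Z_lt_le_dec (e (S (S j))) 1) as [Hlt|]; [|assumption].
  assert (a ^ e (S (S j)) <= a ^ 0) by (apply Z.pow_le_mono_r; lia).
  rewrite Z.pow_1_r in *; rewrite Z.pow_0_r in *; lia. }
destruct k as [|j]; [lia|]; clear Hk.
revert N HN HaN HbN; induction j as [|j IH]; intros N HN HaN HbN.
{ apply nonzero_digits_pos; lia. }
assert (Hpos := He_pos j).
specialize (He (S (S j)) ltac:(lia)); simpl Nat.sub in He.
set (B := b ^ e (S j)) in *.
assert (HB : 0 < B) by (apply Z.pow_pos_nonneg; lia).
assert (HbB : (b | B)).
{ exists (b ^ (e (S j) - 1)); unfold B.
  rewrite Z.mul_comm, <- Z.pow_succ_r by lia; f_equal; lia. }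
assert (HaB : (a ^ e (S j) | B)).
{ destruct Hdvd as [c Hc]; exists (c ^ e (S j)); unfold B.
  rewrite Hc at 1; apply Z.pow_mul_l. }
(* The exponents increase because [a ^ e (S j) <= B < a ^ e (S (S j))]. *)
assert (Hle : e (S j) <= e (S (S j))).
{ apply Z.lt_le_incl, (Z.pow_lt_mono_r_iff a); [lia|specialize (He_pos (S j)); lia|].
  assert (a ^ e (S j) <= B) by (apply Z.divide_pos_le; assumption); lia. }
assert (HaM : (a ^ e (S j) | N mod B)).
{ rewrite Z.mod_eq by lia; apply Z.divide_sub_r.
  - apply Z.divide_trans with (2 := HaN).
    exists (a ^ (e (S (S j)) - e (S j))).
    rewrite <- Z.pow_add_r by lia; f_equal; lia.
  - now apply Z.divide_mul_l. }
assert (HbM : ~ (b | N mod B)).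
{ intros H; apply HbN; rewrite (Z.div_mod N B) by lia.
  apply Z.divide_add_r; [now apply Z.divide_mul_l|exact H]. }
(* A zero low part would be divisible by [b], against [HbM]. *)
assert (HM : 0 < N mod B).
{ assert (Hm := Z.mod_pos_bound N B HB).
  destruct (Z.eq_dec (N mod B) 0) as [E|]; [|lia].
  destruct HbM; rewrite E; apply Z.divide_0_r. }
assert (HQ : 0 < N / B).
{ apply Z.div_str_pos; split; [exact HB|].
  assert (a ^ e (S (S j)) <= N) by (apply Z.divide_pos_le; assumption); lia. }
assert (Hlow := IH _ HM HaM HbM).
assert (Hhigh := nonzero_digits_pos b ltac:(lia) _ HQ).
assert (Hsplit := nonzero_digits_split b ltac:(lia) (Z.to_nat (e (S j))) N ltac:(lia)).
rewrite Z2Nat.id in Hsplit by lia; fold B in Hsplit; lia.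
Qed.
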